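(* There is an absolute constant $c>0$ such that the following holds. Let $L>0$ and let $f:\mathbb{R}^n\to\mathbb{R}$ be an $L$-smooth, possibly non-convex function with $f_{\inf}=\inf_{x\in\mathbb{R}^n}f(x)>-\infty$. Let $m\ge1$, let $\beta_1,\dots,\beta_m\in[0,1)$ be not all zero, put $\beta_{\max}=\max_{1\le i\le m}\beta_i$, and let $\widetilde\beta,\hat\beta\in[0,1)$ be defined by $$\frac1m\sum_{i=1}^m\frac{\beta_i}{(1-\beta_i)^2}=\frac{\widetilde\beta}{(1-\widetilde\beta)^2},\qquad \frac1m\sum_{i=1}^m\frac1{1-\beta_i}=\frac1{1-\hat\beta}.$$ Let $(x_k)_{k\ge0}$ be generated by the Aggregated Heavy-Ball method (AggHB) started at $x_0\in\mathbb{R}^n$ with momentum parameters $\beta_1,\dots,\beta_m$ and equal stepsizes $\gamma_1=\dots=\gamma_m=\gamma$, where $$\gamma=\frac{1}{L\left(\frac{2\hat\beta}{1-\hat\beta}+\sqrt{2\left(\frac{\widetilde\beta}{(1-\widetilde\beta)^2}+\frac1{1-\hat\beta}\right)\frac{1}{(1-\beta_{\max})(1-\hat\beta)}}\right)}.$$ Then for every $\varepsilon>0$, AggHB achieves $\min_{1\le k\le K}\|\nabla f(x_k)\|_2^2\le\varepsilon^2$ after $$K=\mathcal{O}\left(\frac{L(f(x_0)-f_{\inf})}{\varepsilon^2}+\frac{L(f(x_0)-f_{\inf})}{\varepsilon^2}\sqrt{\left(\frac{\widetilde\beta(1-\hat\beta)}{(1-\widetilde\beta)^2}+1\right)\frac{1}{(1-\beta_{\max})\hat\beta^2}}\right)$$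 iterations; that is, $\min_{1\le k\le K}\|\nabla f(x_k)\|_2^2\le\varepsilon^2$ holds for every integer $K\ge1$ which is at least $c$ times the expression inside $\mathcal{O}(\cdot)$.
   Context: A differentiable function $f:\mathbb{R}^n\to\mathbb{R}$ is $L$-smooth if $\|\nabla f(x)-\nabla f(y)\|_2\le L\|x-y\|_2$ for all $x,y\in\mathbb{R}^n$. Aggregated Heavy-Ball method (AggHB): given $x_0\in\mathbb{R}^n$, stepsizes $\gamma_i>0$ and momentum parameters $\beta_i$ ($i=1,\dots,m$), put $V_{-1}^{(i)}=0$ and, for $k=0,1,2,\dots$, $$V_k^{(i)}=\beta_iV_{k-1}^{(i)}+\nabla f(x_k)\quad(i=1,\dots,m),\qquad x_{k+1}=x_k-\frac1m\sum_{i=1}^m\gamma_iV_k^{(i)}.$$ The numbers $\widetilde\beta,\hat\beta$ are well defined because $t\mapsto t/(1-t)^2$ and $t\mapsto1/(1-t)$ are increasing bijections of $[0,1)$ onto $[0,\infty)$ and $[1,\infty)$ respectively. *)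

(* Defs.v *)
From HB Require Import structures.
From mathcomp Require Export all_boot all_order all_algebra.
From mathcomp Require Export all_classical all_reals all_analysis.

Set Implicit Arguments.
Unset Strict Implicit.
Unset Printing Implicit Defensive.

Export Order.TTheory GRing.Theory Num.Theory.
Export numFieldNormedType.Exports.

Local Open Scope ring_scope.

(* The norm `|x| of MathComp-Analysis on 'rV[R]_n is the sup norm.  It induces
   the same notion of differentiability as the Euclidean norm below, but it
   cannot be used to measure gradients. *)
Definition enorm (R : realType) (n : nat) (x : 'rV[R]_n) : R :=
  Num.sqrt (\sum_(i < n) x ord0 i ^+ 2).

Definition gradient (R : realType) (n : nat) (f : 'rV[R]_n -> R)
    (x : 'rV[R]_n) : 'rV[R]_n :=
  \row_(i < n) derive f x (delta_mx ord0 i).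

Definition L_smooth (R : realType) (n : nat) (L : R) (f : 'rV[R]_n -> R) : Prop :=
  (forall x : 'rV[R]_n, differentiable f x) /\
  (forall x y : 'rV[R]_n,
     enorm (gradient f x - gradient f y) <= L * enorm (x - y)).

(* The state at time k is the pair (x_k, (V_{k-1}^(i))_i), with V_{-1} = 0. *)
Fixpoint agghb_state (R : realType) (n m : nat) (f : 'rV[R]_n -> R)
    (gamma beta : 'I_m -> R) (x0 : 'rV[R]_n) (k : nat) :
    'rV[R]_n * ('I_m -> 'rV[R]_n) :=
  if k is k'.+1 then
    let: (x, V) := agghb_state f gamma beta x0 k' in
    let V' := fun i : 'I_m => beta i *: V i + gradient f x in
    (x - m%:R^-1 *: \sum_(i < m) gamma i *: V' i, V')
  else (x0, fun=> 0).

Definition agghb (R : realType) (n m : nat) (f : 'rV[R]_n -> R)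
    (gamma beta : 'I_m -> R) (x0 : 'rV[R]_n) (k : nat) : 'rV[R]_n :=
  (agghb_state f gamma beta x0 k).1.

(* The default value 0 is harmless for the nonnegative families considered. *)
Definition beta_max (R : realType) (m : nat) (beta : 'I_m -> R) : R :=
  \big[Num.max/0]_(i < m) beta i.

(* min_{1 <= k <= K} u_k for K >= 1; the default value u_1 is one of the terms. *)
Definition min_upto (R : realType) (u : nat -> R) (K : nat) : R :=
  \big[Num.min/u 1%N]_(1 <= k < K.+1) u k.

(* Main.v *)
(* The iterates are shifted to z_k = x_k - (gamma/m) sum_i b_i/(1-b_i) V_{k-1}^(i),
   which makes z_{k+1} = z_k - G g_k with g_k the gradient at x_k, h = 1/(1-hat b)
   and G = gamma h.  Smoothness gives
     f(z_{k+1}) <= f(z_k) - (G/2)(1 - L G)|g_k|^2 + (G L^2/2)|z_k - x_k|^2.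
   With B the mean of b_i/(1-b_i)^2, a weighted Cauchy-Schwarz inequality and
   |b V + g|^2 <= b|V|^2 + |g|^2/(1-b) yield
     sum_k |z_k - x_k|^2 <= gamma^2 B^2 sum_k |g_k|^2.
   Since B <= (h - 1)/(1 - beta_max), the prescribed gamma satisfies
   2(h^2 + B^2) <= 1/(L gamma)^2, whence 1 - L G - (L gamma B)^2 >= 1/4, and
   summing up bounds sum_k |g_k|^2 by 8 (f(x_0) - f_inf) / G. *)
Require Import Defs.
From mathcomp Require Import ring lra.

Set Implicit Arguments.
Unset Strict Implicit.
Unset Printing Implicit Defensive.

Local Open Scope classical_set_scope.
Local Open Scope ring_scope.

(** * Euclidean inner product and two convexity inequalities *)

Definition dotp (R : realType) (n : nat) (u v : 'rV[R]_n) : R :=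
  \sum_(i < n) u ord0 i * v ord0 i.

Lemma enorm_sqr (R : realType) (n : nat) (u : 'rV[R]_n) :
  enorm u ^+ 2 = dotp u u.
Proof.
rewrite sqr_sqrtr; last by apply: sumr_ge0 => i _; apply: sqr_ge0.
by apply: eq_bigr => i _; rewrite expr2.
Qed.

Lemma enorm_ge0 (R : realType) (n : nat) (u : 'rV[R]_n) : 0 <= enorm u.
Proof. exact: sqrtr_ge0. Qed.

Lemma dotp_ge0 (R : realType) (n : nat) (u : 'rV[R]_n) : 0 <= dotp u u.
Proof. by rewrite -enorm_sqr sqr_ge0. Qed.

Lemma dotpC (R : realType) (n : nat) (u v : 'rV[R]_n) : dotp u v = dotp v u.
Proof. by apply: eq_bigr => i _; rewrite mulrC. Qed.

Lemma dotpDl (R : realType) (n : nat) (u v w : 'rV[R]_n) :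
  dotp (u + v) w = dotp u w + dotp v w.
Proof. by rewrite -big_split; apply: eq_bigr => i _; rewrite mxE mulrDl. Qed.

Lemma dotpZl (R : realType) (n : nat) (a : R) (u v : 'rV[R]_n) :
  dotp (a *: u) v = a * dotp u v.
Proof. by rewrite mulr_sumr; apply: eq_bigr => i _; rewrite mxE mulrA. Qed.

Lemma dotpDr (R : realType) (n : nat) (u v w : 'rV[R]_n) :
  dotp u (v + w) = dotp u v + dotp u w.
Proof. by rewrite dotpC dotpDl !(dotpC u). Qed.

Lemma dotpZr (R : realType) (n : nat) (a : R) (u v : 'rV[R]_n) :
  dotp u (a *: v) = a * dotp u v.
Proof. by rewrite dotpC dotpZl dotpC. Qed.

Definition dotpE := (dotpDl, dotpDr, dotpZl, dotpZr).

(** The right side minus the left side is exactly b/(1-b) |(1-b) v - g|^2. *)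
Lemma dotp_momentum_le (R : realType) (n : nat) (b : R) (v g : 'rV[R]_n) :
  0 <= b < 1 ->
  dotp (b *: v + g) (b *: v + g) <= b * dotp v v + dotp g g / (1 - b).
Proof.
move=> /andP[b0 b1]; have b1' : 0 < 1 - b by rewrite subr_gt0.
have := dotp_ge0 ((1 - b) *: v + (-1) *: g).
rewrite !dotpE (dotpC g v) => h0.
rewrite -subr_ge0.
set A := dotp v v in h0 *; set C := dotp v g in h0 *; set D := dotp g g in h0 *.
have -> : b * A + D / (1 - b) - (b * (b * A + C) + (b * C + D)) =
  b / (1 - b) * ((1 - b) * ((1 - b) * A + -1 * C) + -1 * ((1 - b) * C + -1 * D)).
  by field; rewrite gt_eqF.
apply: mulr_ge0; first by rewrite divr_ge0 // ltW.
by rewrite !mulrDr.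
Qed.

(** With W the total weight, S the weighted sum and Q the weighted sum of squares, the nonnegative
    sum of w_i (W u_i - S)^2 expands to W (W Q - S^2); then W > 0 is divided out. *)
Lemma sqr_wsum_le (R : realType) (I : finType) (w u : I -> R) :
  (forall i, 0 <= w i) -> 0 < \sum_i w i ->
  (\sum_i w i * u i) ^+ 2 <= (\sum_i w i) * \sum_i w i * u i ^+ 2.
Proof.
move=> w0 W0; set W := \sum_i w i; set S := \sum_i w i * u i.
have : 0 <= \sum_i w i * (W * u i - S) ^+ 2.
  by apply: sumr_ge0 => i _; rewrite mulr_ge0 ?sqr_ge0.
rewrite (eq_bigr (fun i => W ^+ 2 * (w i * u i ^+ 2) +
  (- (2 * W * S) * (w i * u i) + S ^+ 2 * w i))); last by move=> i _; ring.
rewrite !big_split /= -!mulr_sumr -/W -/S; set Q := \sum_i _ => H.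
rewrite -subr_ge0 -(pmulr_rge0 _ W0).
suff -> : W * (W * Q - S ^+ 2) = W ^+ 2 * Q + (- (2 * W * S) * S + S ^+ 2 * W) by [].
ring.
Qed.

Lemma dotp_wsum_le (R : realType) (n : nat) (I : finType) (w : I -> R)
    (v : I -> 'rV[R]_n) :
  (forall i, 0 <= w i) -> 0 < \sum_i w i ->
  dotp (\sum_i w i *: v i) (\sum_i w i *: v i)
    <= (\sum_i w i) * \sum_i w i * dotp (v i) (v i).
Proof.
move=> w0 W0.
under [X in _ <= _ * X]eq_bigr do rewrite mulr_sumr.
rewrite exchange_big mulr_sumr; apply: ler_sum => j _ /=.
rewrite summxE -expr2.
under [X in X ^+ 2 <= _]eq_bigr do rewrite mxE.
under [X in _ <= _ * X]eq_bigr do rewrite -expr2.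
exact: sqr_wsum_le.
Qed.

(** * Directional derivatives and consequences of smoothness *)

Lemma derive_dotp (R : realType) (n : nat) (f : 'rV[R]_n -> R) (x d : 'rV[R]_n) :
  differentiable f x -> derive f x d = dotp (gradient f x) d.
Proof.
move=> df; rewrite deriveE // [in LHS](row_sum_delta d) linear_sum.
apply: eq_bigr => i _.
by rewrite linearZ /= mxE deriveE // mulrC.
Qed.

Lemma is_derive_line (R : realType) (n : nat) (f : 'rV[R]_n -> R)
    (x d : 'rV[R]_n) (t : R) : differentiable f (x + t *: d) ->
  is_derive t 1 (fun s => f (x + s *: d)) (dotp (gradient f (x + t *: d)) d).
Proof.
move=> df.
have E : (fun h : R => h^-1 *: (((fun s => f (x + s *: d)) \o shift t) (h *: 1)
            - f (x + t *: d))) =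
         (fun h : R => h^-1 *: ((f \o shift (x + t *: d)) (h *: d)
            - f (x + t *: d))).
  apply/funext => h /=; congr (_ *: (_ - _)).
  by congr f; rewrite scalerDl addrCA -[h *: 1]/(h * 1) mulr1.
apply: DeriveDef; first by rewrite /derivable E; exact: diff_derivable.
by rewrite -derive_dotp // /derive E.
Qed.

Lemma L_smooth_dotp (R : realType) (n : nat) (L : R) (f : 'rV[R]_n -> R)
    (x y : 'rV[R]_n) : 0 < L -> L_smooth L f ->
  dotp (gradient f x - gradient f y) (gradient f x - gradient f y)
    <= L ^+ 2 * dotp (x - y) (x - y).
Proof.
move=> L0 [_ /(_ x y)] H; rewrite -!enorm_sqr -exprMn.
by rewrite ler_pXn2r // nnegrE ?mulr_ge0 ?enorm_ge0 // ltW.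
Qed.

(** Monotonicity replaces integration along the segment: [p], the restriction of [f] to it minus a t
    + b t^2, has nonpositive derivative on the open unit interval, and the claim is [p 1 <= p 0]. *)
Lemma L_smooth_descent (R : realType) (n : nat) (L : R) (f : 'rV[R]_n -> R)
    (x d : 'rV[R]_n) : 0 < L -> L_smooth L f ->
  f (x + d) <= f x + dotp (gradient f x) d + L / 2 * dotp d d.
Proof.
move=> L0 Lf; have [df _] := Lf.
set a := dotp (gradient f x) d; set b := L / 2 * dotp d d.
pose p (t : R) := f (x + t *: d) + (- a * t + - b * t ^+ 2).
have dp (t : R) : is_derive t (1 : R) p
    (dotp (gradient f (x + t *: d)) d + (- a - 2 * b * t)).
  have := is_derive_line (df (x + t *: d)) => fP.
  have qP : is_derive t (1 : R) (fun s : R => - a * s + - b * s ^+ 2) (- a - 2 * b * t).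
    apply: is_derive_eq; rewrite /GRing.scale /=; ring.
  exact: is_deriveD.
have cp : {within `[0, 1], continuous p}.
  apply: continuous_subspaceT => t; apply/differentiable_continuous/derivable1_diffP.
  by have [] := dp t.
have le10 : p 1 <= p 0.
  apply: (@ler0_derive1_nincr _ p 0 1) => //.
  move=> t; rewrite in_itv /= => /andP[t0 _].
  rewrite derive1E (@derive_val _ _ _ _ _ _ _ (dp t)).
  have := L_smooth_dotp (x + t *: d) x L0 Lf.
  rewrite [x + t *: d - x]addrC addKr dotpZl dotpZr.
  set u := gradient f (x + t *: d) - gradient f x => Hu.
  have -> : dotp (gradient f (x + t *: d)) d = dotp u d + a.
    by rewrite -dotpDl subrK.
  clearbody u.
  (* AM-GM replaces Cauchy-Schwarz: [0 <= |u - L t d|^2]. *)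
  have := dotp_ge0 (u + (- (L * t)) *: d); rewrite !dotpE (dotpC d u) => H0.
  have Lt : 0 < 2 * (L * t) by rewrite !mulr_gt0.
  (* After scaling by 2Lt this reads 2Lt <u,d> <= |u|^2 + (Lt)^2 |d|^2 <= 2 (Lt)^2 |d|^2. *)
  rewrite -(pmulr_rle0 _ Lt) /b; nra.
move: le10; rewrite /p scale0r scale1r addr0; lra.
Qed.

(** The step leaves [z] along the gradient g taken at [x]. With e the gradient error, the descent
    inequality contains -G <e + g, g>; here -<e,g> <= (|e|^2 + |g|^2)/2 and |e| <= L |z - x|. *)
Lemma L_smooth_inexact_step (R : realType) (n : nat) (L G : R)
    (f : 'rV[R]_n -> R) (x z : 'rV[R]_n) : 0 < L -> 0 < G -> L_smooth L f ->
  f (z - G *: gradient f x) <=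
  f z - G / 2 * (1 - L * G) * dotp (gradient f x) (gradient f x)
  + G / 2 * L ^+ 2 * dotp (z - x) (z - x).
Proof.
move=> L0 G0 Lf; set g := gradient f x.
have := L_smooth_descent z (- G *: g) L0 Lf; rewrite scaleNr.
have := L_smooth_dotp z x L0 Lf; rewrite -/g.
set e := gradient f z - g; set Z := dotp (z - x) _ => He.
have -> : gradient f z = e + g by rewrite subrK.
clearbody e; have := dotp_ge0 (e + g).
clearbody Z; rewrite -scaleNr !dotpE (dotpC g e) => H.
have := ler_wpM2l (ltW G0) He; have := mulr_ge0 (ltW G0) H; lra.
Qed.

(** * Energy of the momenta and of the shifted AggHB iterates *)

Lemma sum_momentum_le (R : realType) (n : nat) (b : R) (v g : nat -> 'rV[R]_n) :
  0 <= b < 1 -> v 0%N = 0 -> (forall k, v k.+1 = b *: v k + g k) ->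
  forall K, \sum_(k < K) dotp (v k) (v k)
    <= (\sum_(k < K) dotp (g k) (g k)) / (1 - b) ^+ 2.
Proof.
move=> b01 v0 vS K; have b1 : 0 < 1 - b by rewrite subr_gt0; case/andP: b01.
(* Keeping the last term |v_K|^2 on the left closes the induction: one step adds |v_{K+1}|^2 - b
   |v_K|^2, which is at most |g_K|^2/(1-b). *)
suff H : (1 - b) * \sum_(k < K) dotp (v k) (v k) + dotp (v K) (v K)
    <= (\sum_(k < K) dotp (g k) (g k)) / (1 - b).
  rewrite expr2 invfM mulrA ler_pdivlMr // mulrC; apply: le_trans H.
  by rewrite lerDl dotp_ge0.
elim: K => [|K IH].
  by rewrite !big_ord0 v0 -[0 as X in dotp X](scale0r 0) dotpZl !(mul0r, mulr0, add0r).
rewrite !big_ord_recr /= [in leRHS]mulrDl mulrDr.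
have := dotp_momentum_le (v K) (g K) b01; rewrite -vS; lra.
Qed.

(** Index [k] holds V_{k-1}, so index 0 is the zero initial momentum. *)
Definition agghb_momentum (R : realType) (n m : nat) (f : 'rV[R]_n -> R)
    (gamma beta : 'I_m -> R) (x0 : 'rV[R]_n) (k : nat) : 'I_m -> 'rV[R]_n :=
  (agghb_state f gamma beta x0 k).2.

Lemma agghb_momentumS (R : realType) (n m : nat) (f : 'rV[R]_n -> R)
    (gamma beta : 'I_m -> R) (x0 : 'rV[R]_n) (k : nat) (i : 'I_m) :
  agghb_momentum f gamma beta x0 k.+1 i =
  beta i *: agghb_momentum f gamma beta x0 k i
  + gradient f (agghb f gamma beta x0 k).
Proof. by rewrite /agghb_momentum /agghb /=; case: agghb_state. Qed.

Lemma agghbS (R : realType) (n m : nat) (f : 'rV[R]_n -> R)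
    (gamma beta : 'I_m -> R) (x0 : 'rV[R]_n) (k : nat) :
  agghb f gamma beta x0 k.+1 = agghb f gamma beta x0 k -
  m%:R^-1 *: \sum_i gamma i *: agghb_momentum f gamma beta x0 k.+1 i.
Proof. by rewrite /agghb_momentum /agghb /=; case: agghb_state. Qed.

Definition agghb_shift (R : realType) (n m : nat) (beta : 'I_m -> R)
    (V : 'I_m -> 'rV[R]_n) : 'rV[R]_n :=
  m%:R^-1 *: \sum_i (beta i / (1 - beta i)) *: V i.

(* [beta_i / (1 - beta_i)] is the weight for which the momenta telescope: the
   shifted iterate moves by a multiple of the current gradient alone. *)
Lemma agghb_virtualS (R : realType) (n m : nat) (f : 'rV[R]_n -> R)
    (gamma h : R) (beta : 'I_m -> R) (x0 : 'rV[R]_n) (k : nat) :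
  (forall i, beta i != 1) -> m%:R^-1 * (\sum_i 1 / (1 - beta i)) = h ->
  let x := agghb f (fun=> gamma) beta x0 in
  let V := agghb_momentum f (fun=> gamma) beta x0 in
  x k.+1 - gamma *: agghb_shift beta (V k.+1) =
  x k - gamma *: agghb_shift beta (V k) - (gamma * h) *: gradient f (x k).
Proof.
move=> b1 hE x V; rewrite /x agghbS -/x -/V -!addrA; congr (_ + _).
rewrite -scaler_sumr scalerA [_ * gamma]mulrC -scalerA -!opprD; congr (- _).
rewrite -scalerA -!scalerDr; congr (_ *: _).
rewrite /agghb_shift -hE -scalerA -!scalerDr; congr (_ *: _).
rewrite scaler_suml -!big_split; apply: eq_bigr => i _ /=.
have b1' : 1 - beta i != 0 by rewrite subr_eq0 eq_sym.
(* Since 1 + b/(1-b) = 1/(1-b), the new momentum gets weight 1/(1-b), and unfolding it leaves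
   b/(1-b) on the old one. *)
rewrite -[X in X + _]scale1r -scalerDl [V k.+1 i]agghb_momentumS -/V -/x.
rewrite scalerDr scalerA; congr (_ *: _ + _ *: _); by field.
Qed.

(** The weights w_i = b_i/(1-b_i)^2 reproduce themselves: Cauchy-Schwarz applied to w_i and (1-b_i)
    V_i leaves the coefficient b_i on |V_i|^2, and summing over time turns b_i back into w_i. Both
    factors are then the total weight m B. *)
Lemma sum_agghb_shift_le (R : realType) (n m : nat) (f : 'rV[R]_n -> R)
    (gamma B : R) (beta : 'I_m -> R) (x0 : 'rV[R]_n) :
  (0 < m)%N -> (forall i, 0 <= beta i < 1) -> (exists i, beta i != 0) ->
  m%:R^-1 * (\sum_i beta i / (1 - beta i) ^+ 2) = B ->
  let x := agghb f (fun=> gamma) beta x0 in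
  let s k := agghb_shift beta (agghb_momentum f (fun=> gamma) beta x0 k) in
  forall K, \sum_(k < K) dotp (s k) (s k)
    <= B ^+ 2 * \sum_(k < K) dotp (gradient f (x k)) (gradient f (x k)).
Proof.
move=> m0 b01 [j bj] BE x s K.
set V := agghb_momentum f (fun=> gamma) beta x0 in s *.
set S := \sum_(k < K) dotp (gradient f (x k)) _.
have b1 i : 0 < 1 - beta i by rewrite subr_gt0; case/andP: (b01 i).
pose w i := beta i / (1 - beta i) ^+ 2.
have w0 i : 0 <= w i.
  by rewrite divr_ge0 ?exprn_ge0 ?(ltW (b1 i)) //; case/andP: (b01 i).
have W0 : 0 < \sum_i w i.
  rewrite (bigD1 j) //= ltr_pwDl ?sumr_ge0 // divr_gt0 ?exprn_gt0 //.
  by rewrite lt_neqAle eq_sym bj; case/andP: (b01 j).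
have sE k : s k = m%:R^-1 *: \sum_i w i *: ((1 - beta i) *: V k i).
  congr (_ *: _); apply: eq_bigr => i _; rewrite scalerA; congr (_ *: _).
  by rewrite /w; field; rewrite gt_eqF.
have Vle i : \sum_(k < K) dotp (V k i) (V k i) <= S / (1 - beta i) ^+ 2.
  apply: (@sum_momentum_le _ _ (beta i) (V ^~ i) (fun k => gradient f (x k))) => //.

  by move=> k; rewrite /V agghb_momentumS.
have le1 k : dotp (s k) (s k) <=
    m%:R ^- 2 * ((\sum_i w i) * \sum_i beta i * dotp (V k i) (V k i)).
  rewrite sE dotpZl dotpZr mulrA -expr2 exprVn ler_wpM2l ?invr_ge0 ?exprn_ge0 //.
  apply: le_trans (dotp_wsum_le _ w0 W0) _.
  rewrite le_eqVlt; apply/orP; left; apply/eqP; congr (_ * _).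
  apply: eq_bigr => i _; rewrite dotpZl dotpZr /w; field; by rewrite gt_eqF.
apply: (@le_trans _ _ (\sum_(k < K) m%:R ^- 2 *
    ((\sum_i w i) * \sum_i beta i * dotp (V k i) (V k i)))).
  by apply: ler_sum => k _; apply: le1.
rewrite -BE exprMn exprVn -!mulr_sumr -mulrA ler_wpM2l ?invr_ge0 ?exprn_ge0 //.
rewrite expr2 -mulrA ler_wpM2l ?(ltW W0) // exchange_big /= mulr_suml.
apply: ler_sum => i _; rewrite -mulr_sumr /w mulrAC -mulrA.
by apply: ler_wpM2l => //; case/andP: (b01 i).
Qed.

Lemma agghb_sum_gradient_le (R : realType) (n m : nat) (L gamma h B : R)
    (f : 'rV[R]_n -> R) (beta : 'I_m -> R) (x0 : 'rV[R]_n) :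
  0 < L -> L_smooth L f -> has_lbound (range f) -> 0 < gamma -> 0 < h ->
  (0 < m)%N -> (forall i, 0 <= beta i < 1) -> (exists i, beta i != 0) ->
  m%:R^-1 * (\sum_i beta i / (1 - beta i) ^+ 2) = B ->
  m%:R^-1 * (\sum_i 1 / (1 - beta i)) = h ->
  let x := agghb f (fun=> gamma) beta x0 in
  forall K, gamma * h / 2 * (1 - L * (gamma * h) - (L * gamma * B) ^+ 2)
    * (\sum_(k < K) dotp (gradient f (x k)) (gradient f (x k)))
  <= f x0 - inf (range f).
Proof.
move=> L0 Lf fb g0 h0 m0 b01 bn0 BE hE x K.
set G := gamma * h; have G0 : 0 < G by rewrite mulr_gt0.
pose s k := agghb_shift beta (agghb_momentum f (fun=> gamma) beta x0 k).
pose z k := x k - gamma *: s k.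
pose g k := gradient f (x k).
have b1 i : beta i != 1 by rewrite lt_eqF //; case/andP: (b01 i).
have zS k : z k.+1 = z k - G *: g k by apply: agghb_virtualS.
have zx k : z k - x k = - gamma *: s k by rewrite /z addrAC subrr add0r scaleNr.
have step k : f (z k.+1) <= f (z k) - G / 2 * (1 - L * G) * dotp (g k) (g k)
                    + G / 2 * L ^+ 2 * (gamma ^+ 2 * dotp (s k) (s k)).
  have := L_smooth_inexact_step (x k) (z k) L0 G0 Lf; rewrite -/(g k) -zS /=.
  by rewrite zx dotpZl dotpZr [- gamma * _]mulrA mulrNN -expr2.
have telescope : f (z K) <= f x0 - G / 2 * (1 - L * G) * \sum_(k < K) dotp (g k) (g k)
     + G / 2 * L ^+ 2 * (gamma ^+ 2 * \sum_(k < K) dotp (s k) (s k)).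
  (* In the base case [z 0] is [x0], because the initial momenta vanish. *)
  elim: (K) => [|N IH].
    rewrite !big_ord0 !mulr0 subr0 addr0 /z /s /agghb_shift /x /agghb /=.
    by rewrite big1 ?scaler0 ?subr0 // => i _; rewrite scaler0.
  rewrite !big_ord_recr /=; have := step N; lra.
have := sum_agghb_shift_le f gamma x0 m0 b01 bn0 BE K => /= sle.
have fz : inf (range f) <= f (z K) by apply: ge_inf => //; exists (z K).
have c0 : 0 <= G / 2 * L ^+ 2 * gamma ^+ 2.
  by rewrite !mulr_ge0 ?exprn_ge0 ?invr_ge0 // ltW.
have := ler_wpM2l c0 sle; rewrite -/x -/s.
move: telescope; rewrite /g.
set S := \sum_(k < K) dotp (gradient f (x k)) _; set Q := \sum_(k < K) dotp _ _.
by rewrite !exprMn; lra.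
Qed.

(** * Minimum against mean, and estimates on the parameters and the stepsize *)

Lemma min_upto_mean (R : realType) (u : nat -> R) (K : nat) :
  K%:R * min_upto u K <= \sum_(1 <= k < K.+1) u k.
Proof.
have -> : K%:R * min_upto u K = \sum_(1 <= k < K.+1) min_upto u K.
  by rewrite sumr_const_nat subn1 mulr_natl.
apply: ler_sum_nat => k /andP[k1 kK].
by apply: ge_bigmin_seq => //; rewrite mem_index_iota k1.
Qed.

Lemma beta_max_lt1 (R : realType) (m : nat) (beta : 'I_m -> R) :
  (forall i, beta i < 1) -> beta_max beta < 1.
Proof. by move=> b1; apply: bigmax_lt => // i _; apply: b1. Qed.

(** Termwise, b/(1-b)^2 = (1/(1-b) - 1) / (1-b), and the last factor 1/(1-b) is at most its value at
    [beta_max]. *)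
Lemma mean_momentum_variance_le (R : realType) (m : nat) (beta : 'I_m -> R) :
  (0 < m)%N -> (forall i, 0 <= beta i < 1) ->
  m%:R^-1 * (\sum_i beta i / (1 - beta i) ^+ 2)
  <= (m%:R^-1 * (\sum_i 1 / (1 - beta i)) - 1) / (1 - beta_max beta).
Proof.
move=> m0 b01; set bm := beta_max beta.
have bm1 : 0 < 1 - bm.
  by rewrite subr_gt0 beta_max_lt1 // => i; case/andP: (b01 i).
have mE : 1 = m%:R^-1 * (\sum_(i < m) 1) :> R.
  by rewrite sumr_const card_ord mulVf // pnatr_eq0 -lt0n.
rewrite [X in _ - X]mE -mulrBr -sumrB -mulrA.
rewrite ler_wpM2l ?invr_ge0 // mulr_suml; apply: ler_sum => i _.
have /andP[b0 b1] := b01 i; have b1' : 0 < 1 - beta i by rewrite subr_gt0.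
have -> : 1 / (1 - beta i) - 1 = beta i / (1 - beta i) by field; rewrite gt_eqF.
rewrite expr2 invfM mulrA ler_wpM2l ?divr_ge0 ?(ltW b1') //.
by rewrite lef_pV2 ?posrE // lerD2l lerN2; apply: le_bigmax.
Qed.

(* [D^2 - h D - B^2 - D^2/4] is [(D/2 - h)^2] plus half the slack of the
   hypothesis on [D]. *)
Lemma stepsize_margin (R : realType) (h B D : R) :
  0 < D -> 2 * (h ^+ 2 + B ^+ 2) <= D ^+ 2 -> 1 / 4 <= 1 - h / D - (B / D) ^+ 2.
Proof.
move=> D0 hB; have D20 : 0 < D ^+ 2 by rewrite exprn_gt0.
rewrite -(ler_pM2r D20).
have -> : (1 - h / D - (B / D) ^+ 2) * D ^+ 2 = D ^+ 2 - h * D - B ^+ 2.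
  by field; rewrite gt_eqF.
have := sqr_ge0 (D / 2 - h); nra.
Qed.

(** * Iteration bound for the prescribed stepsize *)

Theorem corollary2p2 (R : realType) :
  exists2 c : R, 0 < c &
  forall (n : nat) (L : R) (f : 'rV[R]_n -> R),
    0 < L -> L_smooth L f -> has_lbound (range f) ->
  forall (m : nat) (beta : 'I_m -> R),
    (1 <= m)%N ->
    (forall i : 'I_m, 0 <= beta i < 1) ->
    (exists i : 'I_m, beta i != 0) ->
  forall betat betah : R,
    0 <= betat < 1 -> 0 <= betah < 1 ->
    m%:R^-1 * (\sum_(i < m) beta i / (1 - beta i) ^+ 2)
      = betat / (1 - betat) ^+ 2 ->
    m%:R^-1 * (\sum_(i < m) 1 / (1 - beta i)) = 1 / (1 - betah) ->
  forall (x0 : 'rV[R]_n) (eps : R), 0 < eps ->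
    let finf := inf (range f) in
    let gamma : R :=
      1 / (L * (2 * betah / (1 - betah)
                + Num.sqrt (2 * (betat / (1 - betat) ^+ 2 + 1 / (1 - betah))
                            * (1 / ((1 - beta_max beta) * (1 - betah)))))) in
    let x := agghb f (fun _ : 'I_m => gamma) beta x0 in
  forall K : nat, (1 <= K)%N ->
    c * (L * (f x0 - finf) / eps ^+ 2
         + L * (f x0 - finf) / eps ^+ 2
           * Num.sqrt ((betat * (1 - betah) / (1 - betat) ^+ 2 + 1)
                       * (1 / ((1 - beta_max beta) * betah ^+ 2))))
      <= K%:R ->
    min_upto (fun k => enorm (gradient f (x k)) ^+ 2) K <= eps ^+ 2.
Proof.
(* 16 = 8 * 2: the coefficient gamma h / 2 * (1/4) gives 8, and [a + s <= (2 + 2 * T) * h] gives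
   2. *)
exists 16 => // n L f L0 Lf fb m beta m0 b01 bn0 bt bh /andP[bt0 bt1] /andP[bh0 bh1].
move=> BE hE x0 eps eps0 finf gamma x K K0 HK.
have := mean_momentum_variance_le m0 b01; rewrite BE hE => Ble.
have bm1 : 0 < 1 - beta_max beta.
  by rewrite subr_gt0 beta_max_lt1 // => i; case/andP: (b01 i).
have bmle : 1 - beta_max beta <= 1.
  rewrite gerBl; case: bn0 => i _.
  by apply: le_trans (le_bigmax _ _ i); case/andP: (b01 i).
have bh1' : 0 < 1 - bh by rewrite subr_gt0.
set B := bt / (1 - bt) ^+ 2 in BE Ble *.
set h := 1 / (1 - bh) in hE Ble *.
pose P := 1 / (1 - beta_max beta).
have P1 : 1 <= P by rewrite ler_pdivlMr // mul1r.
have h1 : 1 <= h by rewrite ler_pdivlMr // mul1r gerBl.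
have h0 : 0 < h := lt_le_trans ltr01 h1.
have hm1 : h - 1 = bh * h by rewrite /h; field; rewrite gt_eqF.
have B0 : 0 < B.
  rewrite -BE mulr_gt0 ?invr_gt0 ?ltr0n //; case: bn0 => j bj.
  have w0 i : 0 <= beta i / (1 - beta i) ^+ 2.
    by rewrite divr_ge0 ?sqr_ge0 //; case/andP: (b01 i).
  rewrite (bigD1 j) //= ltr_pwDl ?sumr_ge0 //; case/andP: (b01 j) => bj0 bj1.
  by rewrite divr_gt0 ?exprn_gt0 ?subr_gt0 // lt_neqAle eq_sym bj.
have {}Ble : B <= (h - 1) * P by rewrite /P div1r.
(* If [bh] were 0, then h = 1 and [Ble] would force B <= 0. *)
have bhpos : 0 < bh.
  by rewrite lt_neqAle bh0 andbT; apply/eqP => E; move: Ble; rewrite hm1 -E; lra.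
set s := Num.sqrt (2 * (B + h) * _) in gamma x *.
have s0 : 0 <= s by apply: sqrtr_ge0.
have s2 : s ^+ 2 = 2 * (B + h) * (P * h).
  rewrite sqr_sqrtr; first by rewrite /P /h; field; rewrite !gt_eqF.
  apply: mulr_ge0; first lra.
  by rewrite divr_ge0 ?mulr_ge0 ?(ltW bm1) ?(ltW bh1').
set a := 2 * bh / (1 - bh) in gamma x *.
have aE : a = 2 * bh * h by rewrite /a /h div1r.
have a0 : 0 < a by rewrite aE; apply: mulr_gt0 => //; apply: mulr_gt0.
have D0 : 0 < a + s by apply: ltr_pwDl.
have g0 : 0 < gamma by apply: divr_gt0 => //; apply: mulr_gt0.
(* The square root alone suffices: s^2 = 2 (B h P + h^2 P), with B <= h P and P >= 1. *)
have marg : 2 * (h ^+ 2 + B ^+ 2) <= (a + s) ^+ 2.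
  apply: (@le_trans _ _ (s ^+ 2)); last first.
    by rewrite ler_pXn2r ?nnegrE ?(ltW D0) // lerDr ltW.
  have H1 : B * B <= B * (h * P) by rewrite ler_wpM2l ?(ltW B0) //; lra.
  have H2 : h * h * 1 <= h * h * P by rewrite ler_wpM2l // mulr_ge0 // ltW.
  by rewrite s2; nra.
(* The sum runs over the indices 0 to K; the term at 0 is dropped later, as the minimum starts at
   1. *)
have := agghb_sum_gradient_le x0 L0 Lf fb g0 h0 m0 b01 bn0 BE hE K.+1.
rewrite -/x -/finf.
have -> : L * (gamma * h) = h / (a + s) by rewrite /gamma; field; rewrite !gt_eqF.
have -> : L * gamma * B = B / (a + s) by rewrite /gamma; field; rewrite !gt_eqF.
have := stepsize_margin D0 marg.
set q := 1 - _ - _ => q4; set S := \sum_(k < _) _ => Sle.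
set u := fun k => _; have S_mean : K%:R * min_upto u K <= S.
  apply: le_trans (min_upto_mean u K) _.
  rewrite /S -(big_mkord xpredT (fun k => dotp (gradient f (x k)) (gradient f (x k)))).
  rewrite [leRHS]big_ltn // -[leLHS]add0r lerD ?dotp_ge0 //.
  by apply: ler_sum_nat => k _; rewrite /u enorm_sqr.
have Sge : 0 <= S by apply: sumr_ge0 => k _; apply: dotp_ge0.
set T := Num.sqrt _ in HK.
have T0 : 0 <= T by apply: sqrtr_ge0.
(* With Y = (B + h) P h one has s^2 = 2Y and (T h)^2 = Y / bh^2 >= Y. *)
have sT : s <= 2 * T * h.
  have Th : 0 <= 2 * T * h by apply: mulr_ge0 (ltW h0); apply: mulr_ge0.
  rewrite -(@ler_pXn2r _ 2) ?nnegrE // s2 (exprMn 2 (2 * T)) (exprMn 2 2 T).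
  rewrite sqr_sqrtr; last first.
    apply: mulr_ge0; last by rewrite divr_ge0 ?mulr_ge0 ?exprn_ge0 ?(ltW bm1).
    by rewrite addr_ge0 // divr_ge0 ?exprn_ge0 ?mulr_ge0 ?(ltW bh1') // subr_ge0 ltW.
  rewrite -[leRHS]mulrA.
  have -> : (bt * (1 - bh) / (1 - bt) ^+ 2 + 1) *
      (1 / ((1 - beta_max beta) * bh ^+ 2)) * h ^+ 2 = (B + h) * (P * h) / bh ^+ 2.
    by rewrite /B /h /P; field; rewrite !gt_eqF // subr_gt0.
  have -> : 2 * (B + h) * (P * h) = 2 * ((B + h) * (P * h)) by rewrite mulrA.
  set Y := (B + h) * (P * h).
  have Y0 : 0 <= Y.
    apply: mulr_ge0; first by rewrite addr_ge0 // ltW.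
    by apply: mulr_ge0; [exact: le_trans P1|exact: ltW].
  have bh2 : bh ^+ 2 <= 1 by rewrite expr_le1 // ltW.
  have : Y <= Y / bh ^+ 2 by rewrite ler_pdivlMr ?exprn_gt0 // ler_piMr.
  lra.
have Dle : a + s <= (2 + 2 * T) * h.
  have : bh * h <= 1 * h by rewrite ler_wpM2r ?(ltW h0) // ltW.
  by rewrite aE; lra.
have SL : S <= 16 * (L * (f x0 - finf) * (1 + T)).
  have D1 : gamma * h / 2 * (1 / 4) * S <= f x0 - finf.
    apply: le_trans Sle; apply: ler_wpM2r => //; apply: ler_wpM2l q4.
    by apply: divr_ge0 => //; apply: mulr_ge0; exact: ltW.
  have finf0 : 0 <= L * (f x0 - finf).
    apply: mulr_ge0; first exact: ltW.
    by rewrite subr_ge0; apply: ge_inf => //; exists x0.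
  (* The inserted factors cancel because gamma = 1/(L (a + s)); this exposes the left side of
     [D1]. *)
  have -> : S = gamma * h / 2 * (1 / 4) * S * (8 * L) * ((a + s) / h).
    by rewrite /gamma; field; rewrite !gt_eqF.
  have D2 : (a + s) / h <= 2 + 2 * T by rewrite ler_pdivrMr.
  apply: (@le_trans _ _ ((f x0 - finf) * (8 * L) * ((a + s) / h))).
    apply: ler_wpM2r; first by apply: divr_ge0; exact: ltW.
    by apply: ler_wpM2r => //; apply: mulr_ge0 => //; exact: ltW.
  have := ler_wpM2l finf0 D2; lra.
have E2 : 0 < eps ^+ 2 by rewrite exprn_gt0.
rewrite -(@ler_pM2l _ K%:R) ?ltr0n //; apply: le_trans S_mean _.
apply: le_trans SL _; rewrite -ler_pdivrMr //; apply: le_trans HK.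
by rewrite le_eqVlt; apply/orP; left; apply/eqP; field; rewrite gt_eqF.
Qed.
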